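(* Let $A\in\mathcal{P}_n$ and $X\in\mathcal{M}_n$. Let $f,g$ be real-valued functions on $(0,\infty)$, with $g$ nowhere zero, such that $\frac{f}{g}$ is a Kwong function on $(0,\infty)$ and $f(t)g(t)\le t$ for all $t>0$. Then $$\omega\big(f(A)Xg(A)+g(A)Xf(A)\big)\le \omega(AX+XA).$$
   Context: $\mathcal{M}_n$ is the algebra of $n\times n$ complex matrices, and $\mathcal{P}_n\subset\mathcal{M}_n$ is the set of positive definite matrices. The numerical radius of $T\in\mathcal{M}_n$ is $\omega(T)=\sup\{|\langle Tx,x\rangle| : x\in\mathbb{C}^n,\ \|x\|=1\}$. For a positive definite matrix $A$ and a real-valued function $f$ on $(0,\infty)$, $f(A)$ is defined by functional calculus (spectral decomposition). A continuous real-valued function $h$ on an interval $(a,b)$ with $a\ge0$ is called a Kwong function if, for any $n$ and any distinct real numbers $a_1,\dots,a_n$ in $(a,b)$, the matrix $\left(\frac{h(a_i)+h(a_j)}{a_i+a_j}\right)_{i,j=1}^n$ is positive semidefinite. *)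

(* Defs.v *)
From mathcomp Require Import all_boot all_order all_algebra.
From mathcomp Require Import sesquilinear spectral complex.
From mathcomp Require Import all_classical all_reals all_analysis.

Set Implicit Arguments.
Unset Strict Implicit.
Unset Printing Implicit Defensive.

Import Order.TTheory GRing.Theory Num.Theory.
Import numFieldNormedType.Exports.

Local Open Scope classical_set_scope.
Local Open Scope ring_scope.
Local Open Scope sesquilinear_scope.
Local Open Scope complex_scope.

(* Linear in the first argument, conjugate-linear in the second. *)
Definition inner (R : realType) (n : nat) (x y : 'cV[R[i]]_n) : R[i] :=
  (y^t* *m x) 0 0.

(* The library norm on matrices is the sup norm, hence this definition. *)
Definition l2norm (R : realType) (n : nat) (x : 'cV[R[i]]_n) : R[i] :=
  sqrtC (inner x x).

(* In the partial order of R[i], 0 <= z entails that z is real. *)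
Definition psdmx (R : realType) (n : nat) (A : 'M[R[i]]_n) : Prop :=
  A \is hermsymmx /\ forall x : 'cV[R[i]]_n, 0 <= inner (A *m x) x.

Definition posdefmx (R : realType) (n : nat) (A : 'M[R[i]]_n) : Prop :=
  A \is hermsymmx /\
  forall x : 'cV[R[i]]_n, x != 0 -> 0 < inner (A *m x) x.

(* For n = 0 the set is empty and the library supremum is 0. *)
Definition numradius (R : realType) (n : nat) (T : 'M[R[i]]_n) : R :=
  sup [set complex.Re `|inner (T *m x) x| | x in
        [set x : 'cV[R[i]]_n | l2norm x = 1]].

(* Meaningful for hermitian A, whose spectral values are all real; then
   A = invmx (spectralmx A) *m diag_mx (spectral_diag A) *m spectralmx A
   with spectralmx A unitary. *)
Definition funcalc (R : realType) (n : nat) (f : R -> R) (A : 'M[R[i]]_n) :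
    'M[R[i]]_n :=
  invmx (spectralmx A)
    *m diag_mx (map_mx (fun z : R[i] => (f (complex.Re z))%:C) (spectral_diag A))
    *m spectralmx A.

Definition kwong_matrix (R : realType) (m : nat) (h : R -> R) (a : 'I_m -> R) :
    'M[R[i]]_m :=
  \matrix_(i < m, j < m) ((h (a i) + h (a j)) / (a i + a j))%:C.

Definition open_itv (R : realType) (a : R) (b : \bar R) : set R :=
  [set t | a < t /\ (t%:E < b)%E].

Definition kwong (R : realType) (a : R) (b : \bar R) (h : R -> R) : Prop :=
  [/\ 0 <= a,
      {within open_itv a b, continuous h} &
      forall (m : nat) (t : 'I_m -> R),
        injective t -> (forall i, open_itv a b (t i)) ->
        psdmx (kwong_matrix h t)].

(* Main.v *)
Require Import Defs.
From mathcomp Require Import all_boot all_order all_algebra.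
From mathcomp Require Import sesquilinear spectral complex.
From mathcomp Require Import all_classical all_reals all_analysis.
From mathcomp Require Import ring.

Local Open Scope ring_scope.
Local Open Scope complex_scope.

(** Diagonalize [A = S^t* *m diag lam *m S] with [S] unitary and [lam i > 0].
    The numerical radius is invariant under unitary similarity, so with
    [Y = S *m X *m S^t*] the matrices to compare have the entries
<<
      (f (lam i) * g (lam j) + g (lam i) * f (lam j)) * Y i j
      (lam i + lam j) * Y i j
>>
    The first is therefore the entrywise (Schur) product of the second with
<<
      K i j = g (lam i) * (h (lam i) + h (lam j)) / (lam i + lam j) * g (lam j),
      h = f / g.
>>
    [K] is a congruence, by the diagonal matrix of the [g (lam i)], of the
    Kwong matrix of [h]; hence it is positive semidefinite.  Its diagonal is
    [f (lam i) * g (lam i) / lam i <= 1].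

    It remains to see that Schur multiplication by a positive semidefinite [K]
    with diagonal at most 1 does not increase the numerical radius
    ([numradius_schur]).  Write [K = V^t* *m V] and let [w k] be the entrywise
    product of [x] with row [k] of [V].  Then
    [<(K o T) x, x> = \sum_k <T (w k), w k>] ([inner_schur_gram]), which is at
    most [numradius T * \sum_k <w k, w k>] in modulus; and the same identity
    for [T = 1] gives
    [\sum_k <w k, w k> = \sum_i K i i * `|x i| ^+ 2 <= <x, x>].

    The Kwong hypothesis speaks of distinct points, whereas eigenvalues may be
    repeated; [kwong_matrix_psd] bridges the two by a congruence that
    duplicates rows and columns. *)

Import Order.TTheory GRing.Theory Num.Theory.
Local Open Scope sesquilinear_scope.

(** * Products of similar matrices *)

Section Similarity.
Context {F : comNzRingType} {n : nat}.
Implicit Types S T P Q X : 'M[F]_n.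

Lemma mulmx_similar_sandwich S T P Q X :
  T *m P *m S *m X *m (T *m Q *m S) = T *m (P *m (S *m X *m T) *m Q) *m S.
Proof. by rewrite !mulmxA. Qed.

Lemma mulmx_similar_anticomm S T P X : T *m S = 1%:M ->
  T *m P *m S *m X + X *m (T *m P *m S) =
  T *m (P *m (S *m X *m T) + S *m X *m T *m P) *m S.
Proof.
move=> TS; rewrite mulmxDr mulmxDl; congr (_ + _); last first.
  by rewrite !mulmxA TS mul1mx.
by rewrite -!mulmxA TS mulmx1.
Qed.

End Similarity.

(** * The inner product *)

Section InnerProduct.
Context {R : realType} {n : nat}.
Implicit Types (x y : 'cV[R[i]]_n) (T : 'M[R[i]]_n).

Lemma inner_adjoint m (B : 'M[R[i]]_(m, n)) x (y : 'cV[R[i]]_m) :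
  inner (B *m x) y = inner x (B^t* *m y).
Proof. by rewrite /inner trmx_mul map_mxM trmxCK mulmxA. Qed.

Lemma innerE x y : inner x y = \sum_i Num.conj (y i 0) * x i 0.
Proof. by rewrite /inner mxE; apply: eq_bigr => i _; rewrite !mxE. Qed.

Lemma innerxx x : inner x x = \sum_i `|x i 0| ^+ 2.
Proof. by rewrite innerE; apply: eq_bigr => i _; rewrite mulrC -normCK. Qed.

Lemma innerxx_ge0 x : 0 <= inner x x.
Proof. by rewrite innerxx sumr_ge0 // => i _; rewrite exprn_ge0. Qed.

Lemma innerxx_eq0 x : (inner x x == 0) = (x == 0).
Proof.
rewrite innerxx; apply/idP/eqP => [|->]; last first.
  by apply/eqP; apply: big1 => i _; rewrite mxE normr0 expr0n.
rewrite psumr_eq0; last by move=> i _; rewrite exprn_ge0.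
move=> /allP x0; apply/colP => i; rewrite mxE; apply/eqP.
have := x0 i (mem_index_enum i).
by rewrite /= expf_eq0 /= normr_eq0.
Qed.

Lemma l2norm_eq1 x : (l2norm x = 1) <-> (inner x x = 1).
Proof.
rewrite /l2norm; split => [h|->]; last exact: sqrtC1.
by rewrite -[LHS]sqrtCK h expr1n.
Qed.

Lemma inner_mulE T x y :
  inner (T *m x) y = \sum_i \sum_j Num.conj (y i 0) * T i j * x j 0.
Proof.
rewrite innerE; apply: eq_bigr => i _; rewrite mxE mulr_sumr.
by apply: eq_bigr => j _; rewrite mulrA.
Qed.

End InnerProduct.

(** * The numerical radius *)

Section NumericalRadius.
Context {R : realType} {n : nat}.
Implicit Types (x : 'cV[R[i]]_n) (T S : 'M[R[i]]_n).

Lemma normC_Re (z : R[i]) : (complex.Re `|z|)%:C = `|z|.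
Proof. by rewrite RRe_real // realE normr_ge0. Qed.

Local Open Scope classical_set_scope.

(** The entries of a unit vector have modulus at most 1, so the sum of the
    moduli of the entries of [T] is a bound. *)
Lemma numradius_has_ubound T :
  has_ubound [set complex.Re `|inner (T *m x) x| | x in
               [set x : 'cV[R[i]]_n | l2norm x = 1]].
Proof.
exists (complex.Re (\sum_i \sum_j `|T i j|)) => _ [x /= /l2norm_eq1 x1 <-].
suff : `|inner (T *m x) x| <= \sum_i \sum_j `|T i j|.
  by rewrite lecE => /andP[].
have xi1 i : `|x i 0| <= 1.
  rewrite -(@expr_le1 _ 2) // -x1 innerxx (bigD1 i) //= lerDl.
  by rewrite sumr_ge0 // => k _; rewrite exprn_ge0.
rewrite inner_mulE; apply: (le_trans (ler_norm_sum _ _ _)).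
apply: ler_sum => i _; apply: (le_trans (ler_norm_sum _ _ _)).
apply: ler_sum => j _; rewrite !normrM norm_conjC mulrAC.
by rewrite ler_piMl // mulr_ile1.
Qed.

Lemma numradius_ge0 T : 0 <= numradius T.
Proof.
rewrite /numradius; set W := (X in sup X).
(* In dimension 0 there is no unit vector. *)
have [->|/set0P[_ [x x1 _]]] := eqVneq W set0; first by rewrite sup0.
apply: (@le_trans _ _ (complex.Re `|inner (T *m x) x|)).
  by rewrite -lecR normC_Re normr_ge0.
by apply: ub_le_sup; [exact: numradius_has_ubound | exists x].
Qed.

(** The defining bound on unit vectors extends to all vectors because both
    sides are homogeneous of degree 2. *)
Lemma le_numradius T x :
  `|inner (T *m x) x| <= (numradius T)%:C * inner x x.
Proof.
have [->|x0] := eqVneq x 0.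
  by rewrite mulmx0 innerxx big1 ?mulr0 ?innerE ?big1 ?normr0 // => i _;
     rewrite mxE ?normr0 ?expr0n ?mulr0.
have x_gt0 : 0 < inner x x by rewrite lt0r innerxx_eq0 x0 innerxx_ge0.
pose c := (sqrtC (inner x x))^-1.
have c2 : Num.conj c * c = (inner x x)^-1.
  rewrite mulrC -normCK ger0_norm ?invr_ge0 ?sqrtC_ge0 ?innerxx_ge0 //.
  by rewrite exprVn sqrtCK.
have innerZ y z : inner (c *: y) (c *: z) = (inner x x)^-1 * inner y z.
  rewrite [LHS]innerE (innerE y) mulr_sumr; apply: eq_bigr => i _.
  by rewrite !mxE rmorphM mulrACA /= c2.
have : `|inner (T *m (c *: x)) (c *: x)| <= (numradius T)%:C.
  rewrite -normC_Re lecR; apply: ub_le_sup; first exact: numradius_has_ubound.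
  exists (c *: x) => //=; apply/l2norm_eq1.
  by rewrite innerZ mulVf // gt_eqF.
rewrite -scalemxAr innerZ normrM normfV (ger0_norm (ltW x_gt0)) mulrC.
by rewrite ler_pdivrMr.
Qed.

(** Requiring [0 <= c] covers dimension 0, where the numerical radius is the
    supremum of the empty set. *)
Lemma numradius_le T (c : R) : 0 <= c ->
  (forall x, inner x x = 1 -> `|inner (T *m x) x| <= c%:C) -> numradius T <= c.
Proof.
move=> c0 Tc; rewrite /numradius; set W := (X in sup X).
have [->|/set0P W0] := eqVneq W set0; first by rewrite sup0.
apply: ge_sup => // _ [x /= /l2norm_eq1 x1 <-].
by rewrite -lecR normC_Re Tc.
Qed.

Lemma numradius_conj_le T {S} : S \is unitarymx ->
  numradius (S^t* *m T *m S) <= numradius T.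
Proof.
move=> uS; have SS : S^t* *m S = 1%:M.
  by rewrite -invmx_unitary // mulVmx // unitarymx_unit.
apply: numradius_le => [|x x1]; first exact: numradius_ge0.
have -> : inner (S^t* *m T *m S *m x) x = inner (T *m (S *m x)) (S *m x).
  by rewrite -!mulmxA [LHS]inner_adjoint trmxCK.
apply: (le_trans (le_numradius _ _)).
by rewrite inner_adjoint mulmxA SS mul1mx x1 mulr1.
Qed.

Lemma numradius_conj T {S} : S \is unitarymx ->
  numradius (S^t* *m T *m S) = numradius T.
Proof.
move=> uS; apply/eqP; rewrite eq_le; apply/andP; split.
  exact: numradius_conj_le.
have SS : S *m S^t* = 1%:M by apply/unitarymxP.
have uS' : S^t* \is unitarymx by rewrite trmxC_unitary.
have ST : S^t*^t* *m (S^t* *m T *m S) *m S^t* = T.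
  by rewrite trmxCK !mulmxA SS mul1mx -mulmxA SS mulmx1.
by rewrite -{1}ST; exact: numradius_conj_le.
Qed.

End NumericalRadius.

(** * Positive matrices *)

Section Positivity.
Context {R : realType}.

(** The witness is the [i]-th vector of the spectral basis; this turns a sign
    condition on the quadratic form into one on the spectrum. *)
Lemma spectral_diag_rayleigh {n} (A : 'M[R[i]]_n) (i : 'I_n) :
  A \is hermsymmx ->
  exists2 v : 'cV[R[i]]_n, v != 0 & spectral_diag A 0 i = inner (A *m v) v.
Proof.
move=> /hermitian_normalmx /orthomx_spectralP eA.
set S := spectralmx A in eA *; set d := spectral_diag A in eA *.
have uS : S \is unitarymx := spectral_unitarymx A.
rewrite invmx_unitary // in eA.
have SS : S *m S^t* = 1%:M by apply/unitarymxP.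
have SK (v : 'cV[R[i]]_n) : S *m (S^t* *m v) = v by rewrite mulmxA SS mul1mx.
exists (S^t* *m delta_mx i 0).
  apply/eqP => /(congr1 (mulmx S)); rewrite SK mulmx0.
  by move/matrixP/(_ i 0); rewrite !mxE !eqxx; move/eqP; rewrite oner_eq0.
rewrite eA -!mulmxA inner_adjoint trmxCK !SK.
rewrite mul_diag_mx innerE (bigD1 i) //= big1 => [|j ji].
  by rewrite !mxE !eqxx rmorph1 mul1r mulr1 addr0.
by rewrite !mxE (negPf ji) rmorph0 mul0r.
Qed.

Lemma posdefmx_spectral {n} {A : 'M[R[i]]_n} : posdefmx A ->
  exists (S : 'M[R[i]]_n) (lam : 'I_n -> R),
  [/\ S \is unitarymx, forall i, 0 < lam i,
      A = S^t* *m diag_mx (\row_i (lam i)%:C) *m S &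
      forall p : R -> R,
        funcalc p A = S^t* *m diag_mx (\row_i (p (lam i))%:C) *m S].
Proof.
move=> [hermA posA].
have uS : spectralmx A \is unitarymx := spectral_unitarymx A.
have d_gt0 i : 0 < spectral_diag A 0 i.
  by have [v v0 ->] := spectral_diag_rayleigh A i hermA; rewrite posA.
exists (spectralmx A), (fun i => complex.Re (spectral_diag A 0 i)); split.
- exact: uS.
- by move=> i; rewrite -ltcR RRe_real // gtr0_real.
- have -> : \row_i (complex.Re (spectral_diag A 0 i))%:C = spectral_diag A.
    by apply/rowP => i; rewrite mxE RRe_real // gtr0_real.
  rewrite -(invmx_unitary uS).
  exact/orthomx_spectralP/hermitian_normalmx.
- move=> p; rewrite /funcalc (invmx_unitary uS).
  have -> : map_mx (fun z : R[i] => (p (complex.Re z))%:C) (spectral_diag A) =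
            \row_i (p (complex.Re (spectral_diag A 0 i)))%:C.
    by apply/rowP => i; rewrite !mxE.
  by [].
Qed.

(** Take the square roots of the eigenvalues in a spectral decomposition. *)
Lemma psdmx_gram n (K : 'M[R[i]]_n) : psdmx K ->
  exists V : 'M[R[i]]_n, K = V^t* *m V.
Proof.
move=> [hK posK].
have d_ge0 i : 0 <= spectral_diag K 0 i.
  by have [v _ ->] := spectral_diag_rayleigh K i hK.
exists (diag_mx (map_mx sqrtC (spectral_diag K)) *m spectralmx K).
have /orthomx_spectralP {1}-> := hermitian_normalmx hK.
rewrite invmx_unitary ?spectral_unitarymx // trmx_mul map_mxM.
rewrite tr_diag_mx map_diag_mx !mulmxA; congr (_ *m _).
rewrite -[RHS]mulmxA; congr (_ *m _); rewrite mulmx_diag; congr diag_mx.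
apply/rowP => i; rewrite !mxE /= geC0_conj ?sqrtC_ge0 //.
by rewrite -expr2 sqrtCK.
Qed.

Lemma psdmx_congr m n (K : 'M[R[i]]_m) (B : 'M[R[i]]_(m, n)) :
  psdmx K -> psdmx (B^t* *m K *m B).
Proof.
move=> [hK posK]; split; last first.
  by move=> x; rewrite -!mulmxA inner_adjoint trmxCK.
apply/is_hermitianmxP; rewrite expr0 scale1r.
move/is_hermitianmxP: hK; rewrite expr0 scale1r => hK.
by rewrite !trmx_mul !map_mxM trmxCK -hK mulmxA.
Qed.

End Positivity.

(** * Schur multipliers *)

Section SchurMultiplier.
Context {R : realType} {n : nat}.
Implicit Types K T V : 'M[R[i]]_n.

Definition schurmx K T : 'M[R[i]]_n := \matrix_(i, j) (K i j * T i j).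

(** Row [k] of [V] contributes to [V^t* *m V] a matrix of rank one, and the
    Schur product with it is [T |-> D^t* *m T *m D] where [D] is the diagonal
    matrix of that row. *)
Lemma inner_schur_gram V T (x : 'cV[R[i]]_n) :
  inner (schurmx (V^t* *m V) T *m x) x =
  \sum_k inner (T *m (\col_j (V k j * x j 0))) (\col_j (V k j * x j 0)).
Proof.
under eq_bigr => k _ do rewrite inner_mulE.
rewrite inner_mulE [RHS]exchange_big /=; apply: eq_bigr => i _.
rewrite [RHS]exchange_big /=; apply: eq_bigr => j _.
rewrite !mxE mulr_suml mulr_sumr mulr_suml; apply: eq_bigr => k _.
by rewrite !mxE rmorphM /=; ring.
Qed.

(** The decomposition [inner_schur_gram] is used twice: for [T], to bound each
    summand by the numerical radius of [T], and then for the identity matrix,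
    to add up the squared norms that remain. *)
Lemma numradius_schur K T : psdmx K -> (forall i, K i i <= 1) ->
  numradius (schurmx K T) <= numradius T.
Proof.
move=> /psdmx_gram [V ->] K1.
apply: numradius_le => [|x x1]; first exact: numradius_ge0.
rewrite inner_schur_gram; apply: (le_trans (ler_norm_sum _ _ _)).
apply: (le_trans (ler_sum _ (fun k _ => le_numradius T _))).
rewrite -mulr_sumr ler_piMr ?ler0c ?numradius_ge0 //.
under eq_bigr => k _ do rewrite -[X in inner X _]mul1mx.
rewrite -inner_schur_gram -[leRHS]x1 innerxx innerE.
apply: ler_sum => i _; rewrite mxE (bigD1 i) //= big1 => [|j ji].
  rewrite !mxE eqxx mulr1 addr0 mulrCA [Num.conj _ * _]mulrC -normCK.
  by rewrite ler_piMl ?exprn_ge0 //; have := K1 i; rewrite mxE.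
by rewrite !mxE eq_sym (negPf ji) mulr0 mul0r.
Qed.

End SchurMultiplier.

(** * Kwong matrices with repeated points *)

Section KwongMatrices.
Context {R : realType}.

(** List the distinct values [u] of [t]; the matrix at [t] is the congruence
    of the matrix at [u] by the incidence matrix of [t i = u k]. *)
Lemma kwong_matrix_psd {n} {h : R -> R} {b : \bar R} {t : 'I_n -> R} :
  kwong 0 b h -> (forall i, open_itv 0 b (t i)) -> psdmx (kwong_matrix h t).
Proof.
move=> [_ _ Kh] t_in.
pose s := undup (codom t).
have ts i : (index (t i) s < size s)%N by rewrite index_mem mem_undup codom_f.
pose u (k : 'I_(size s)) := nth 0 s k.
pose r i := Ordinal (ts i).
have ur i : u (r i) = t i by rewrite /u nth_index // mem_undup codom_f.
have u_inj : injective u.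
  by move=> k l /eqP; rewrite nth_uniq ?undup_uniq // => /eqP/val_inj.
have u_in k : open_itv 0 b (u k).
  have : u k \in codom t by rewrite -mem_undup mem_nth.
  by move=> /codomP[i ->].
have -> : kwong_matrix h t = let B := \matrix_(k, i) (k == r i)%:R in
    B^t* *m kwong_matrix h u *m B.
  apply/matrixP => i j; rewrite /= -mulmxA [RHS]mxE (bigD1 (r i)) //= big1.
    rewrite addr0 !mxE eqxx rmorph1 mul1r (bigD1 (r j)) //= big1.
      by rewrite !mxE eqxx mulr1 addr0 !ur.
    by move=> k kr; rewrite !mxE (negPf kr) mulr0.
  by move=> k kr; rewrite !mxE (negPf kr) rmorph0 mul0r.
exact/psdmx_congr/Kh.
Qed.

End KwongMatrices.

(** * The inequality *)

Theorem theorem4p3 (R : realType) (n : nat) (A X : 'M[R[i]]_n) (f g : R -> R)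
    (hA : posdefmx A)
    (hg : forall t : R, 0 < t -> g t != 0)
    (hK : kwong 0 +oo%E (fun t => f t / g t))
    (hfg : forall t : R, 0 < t -> f t * g t <= t) :
  numradius (funcalc f A *m X *m funcalc g A + funcalc g A *m X *m funcalc f A)
    <= numradius (A *m X + X *m A).
Proof.
have [S [lam [uS lam_gt0 A_E funcalcE]]] := posdefmx_spectral hA.
have SS : S^t* *m S = 1%:M.
  by rewrite -(invmx_unitary uS) mulVmx // unitarymx_unit.
pose D (p : R -> R) : 'M[R[i]]_n := diag_mx (\row_i (p (lam i))%:C).
have {}funcalcE p : funcalc p A = S^t* *m D p *m S := funcalcE p.
have {}A_E : A = S^t* *m D id *m S := A_E.
pose Y := S *m X *m S^t*.
have -> : funcalc f A *m X *m funcalc g A + funcalc g A *m X *m funcalc f A =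
    S^t* *m (D f *m Y *m D g + D g *m Y *m D f) *m S.
  rewrite mulmxDr mulmxDl !funcalcE.
  by congr (_ + _); exact: mulmx_similar_sandwich.
have -> : A *m X + X *m A = S^t* *m (D id *m Y + Y *m D id) *m S.
  by rewrite {1 2}A_E; exact: mulmx_similar_anticomm.
clearbody Y.
rewrite [leLHS](numradius_conj _ uS) [leRHS](numradius_conj _ uS).
pose K := (D g)^t* *m kwong_matrix (fun t => f t / g t) lam *m D g.
have conj_real (a : R) : Num.conj (a%:C) = a%:C :> R[i] by exact: conjc_real.
have KE i j : K i j =
    ((f (lam i) * g (lam j) + g (lam i) * f (lam j)) / (lam i + lam j))%:C.
  rewrite /K tr_diag_mx map_diag_mx mul_diag_mx mul_mx_diag !mxE.
  rewrite /= conj_real -!rmorphM; congr (_ %:C).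
  field; do ?[apply/andP; split]; rewrite ?hg ?lam_gt0 //.
  by rewrite gt_eqF // addr_gt0.
have -> : D f *m Y *m D g + D g *m Y *m D f =
    schurmx K (D id *m Y + Y *m D id).
  apply/matrixP => i j; rewrite !mul_diag_mx !mul_mx_diag [RHS]mxE KE !mxE.
  rewrite [Y i j * (lam j)%:C]mulrC -mulrDl -rmorphD mulrA -rmorphM /= divfK.
    by rewrite rmorphD !rmorphM /=; ring.
  by rewrite gt_eqF // addr_gt0.
apply: numradius_schur => [|i].
  apply: psdmx_congr; apply: (kwong_matrix_psd hK) => i.
  by split; [exact: lam_gt0 | exact: ltry].
rewrite KE lecR ler_pdivrMr ?addr_gt0 // mul1r [g _ * _]mulrC.
by rewrite lerD ?hfg.
Qed.
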